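(* The coupled system $$\left\{\begin{array}{l}\Omega a+w_{2n}b-\sigma(|a|^2+2|b|^2)a=\epsilon A_\epsilon(a,b),\\ \Omega b+w_{-2n}a-\sigma(2|a|^2+|b|^2)b=\epsilon B_\epsilon(a,b)\end{array}\right.$$ (with $A_\epsilon,B_\epsilon$ as defined in the context) admits a symmetry reduction $a=\bar b$, where the value of $a\in\mathbb{C}$ satisfies the scalar equation $$\Omega a+w_{2n}\bar a-3\sigma|a|^2a=\epsilon A_\epsilon(a,\bar a).$$ That is, with $b=\bar a$ the two equations of the system are equivalent to this single scalar equation. Under the reduction, the corresponding solution $U(x)$ of the elliptic problem is real-valued.
   Context: Let $W:\mathbb{R}\to\mathbb{R}$ be smooth, $2\pi$-periodic, with zero mean and $W(-x)=W(x)$, with Fourier series $W(x)=\sum_{m\in\mathbb{Z}}w_{2m}e^{imx}$, $\sum_m(1+m^2)^s|w_{2m}|^2<\infty$ for all $s>\frac12$, $w_0=0$, $w_{2m}=w_{-2m}=\bar w_{2m}$. Fix $n\in\mathbb{N}$ with $w_{2n}\ne0$, real $\sigma,\Omega$, and let $\omega^2=\frac{n^2}{4}+\epsilon\Omega$ with $\epsilon>0$ small. The elliptic problem is $U''+\omega^2U+\epsilon W(x)U=\sigma|U|^2U$ on $\mathbb{R}$, $U:\mathbb{R}\to\mathbb{C}$. Let $\mathbb{Z}'$ be the set of even integers if $n$ is even and of odd integers if $n$ is odd. Let $s>\frac12$ and let $l^2_s(\mathbb{Z}')$ be the space of sequences with $\|\mathbf{U}\|^2=\sum_{m\in\mathbb{Z}'}(1+\frac{m^2}{4})^s|U_m|^2<\infty$.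 Writing $U(x)=\sqrt\epsilon\sum_{m\in\mathbb{Z}'}U_me^{\frac i2mx}$, the elliptic problem becomes the lattice system $$\left(\omega^2-\tfrac{m^2}{4}\right)U_m+\epsilon\sum_{m_1\in\mathbb{Z}'}w_{m-m_1}U_{m_1}=\epsilon\sigma\, N_m(\mathbf{U}),\qquad N_m(\mathbf{U})=\sum_{m_1,m_2\in\mathbb{Z}'}U_{m_1}\bar U_{-m_2}U_{m-m_1-m_2},\qquad m\in\mathbb{Z}'.$$ Definition of $A_\epsilon,B_\epsilon$: decompose $U_m=a\delta_{m,n}+b\delta_{m,-n}+g_m$ with $\mathbf{g}\in l^2_s(\mathbb{Z}')$, $g_n=g_{-n}=0$. For fixed $\delta>0$, all $|a|+|b|<\delta$ and $\epsilon$ sufficiently small, the lattice equations with $m\ne\pm n$ have a unique solution $\mathbf{g}=\mathbf{G}_\epsilon(a,b)$ near $\mathbf{0}$, analytic in $\epsilon$, with $\|\mathbf{G}_\epsilon(a,b)\|_{l^2_s(\mathbb{Z}')}\le C\epsilon(|a|+|b|)$. With $\mathbf{g}=\mathbf{G}_\epsilon(a,b)$, set $$\epsilon A_\epsilon(a,b)=-\sum_{k\in\mathbb{Z}'\setminus\{n,-n\}}w_{n-k}g_k+\sigma\left[N_n(\mathbf{U})-(|a|^2+2|b|^2)a\right],$$ $$\epsilon B_\epsilon(a,b)=-\sum_{k\in\mathbb{Z}'\setminus\{n,-n\}}w_{-n-k}g_k+\sigma\left[N_{-n}(\mathbf{U})-(2|a|^2+|b|^2)b\right],$$ so that the coupled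 system is the pair of lattice equations at $m=\pm n$ divided by $\epsilon$. The solution $U$ corresponding to a solution $(a,b)$ of the coupled system is $U(x)=\sqrt\epsilon\,\big(ae^{\frac{inx}{2}}+be^{-\frac{inx}{2}}+\sum_{m}g_me^{\frac i2mx}\big)$ with $\mathbf g=\mathbf{G}_\epsilon(a,b)$. *)

(* Defs.v *)
(* Complex numbers are R[i] for a realType R; z^* is conjc and normc the real-valued
   modulus, whereas `|z| is an element of R[i]. *)
From HB Require Import structures.
From mathcomp Require Export all_boot all_order all_algebra finmap.
From mathcomp Require Export all_classical all_reals all_analysis.
From mathcomp Require Export complex showcase.summability.

Set Implicit Arguments.
Unset Strict Implicit.
Unset Printing Implicit Defensive.

Export Order.TTheory GRing.Theory Num.Theory numFieldNormedType.Exports.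
Export Normc.

Local Open Scope classical_set_scope.
Local Open Scope ring_scope.
Local Open Scope complex_scope.

Section Analysis.
Context {R : realType}.

(* The unordered sum of f over D: the limit of the finite partial sums along
   the directed set of finite subsets of the index type. *)
Definition csum {I : choiceType} (D : set I) (f : I -> R[i]) : R[i] :=
  sum (patch (fun=> 0) D f : I -> R[i]^o).

Definition expi (x : R) : R[i] := cos x +i* sin x.

Definition cintegral (D : set R) (f : R -> R[i]) : R[i] :=
  Rintegral lebesgue_measure D (fun x => complex.Re (f x)) +i*
  Rintegral lebesgue_measure D (fun x => complex.Im (f x)).

Definition smooth (W : R -> R) := forall (k : nat) (x : R),
  derivable (derive1n k W) x 1.

Definition fourier_coef (W : R -> R) (m : int) : R[i] :=
  ((2 * pi)^-1)%:C *
  cintegral `[- pi, pi] (fun x => (W x)%:C * expi (- (m%:~R * x))).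

(* w_k for an even integer k = 2m is the coefficient of e^{imx} in W; the value
   at an odd k is never used. *)
Definition wcoef (W : R -> R) (k : int) : R[i] := fourier_coef W (k %/ 2)%Z.

End Analysis.

Section Lattice.
Context {R : realType}.
Variable n : nat.

Definition Zpar : set int := [set m : int | odd `|m|%N = odd n].

(* Elements of l^2_s(Z') are represented by functions on all of int, of which
   only the values on Z' are relevant. *)
Definition l2s_sqnorm (s : R) (g : int -> R[i]) : \bar R :=
  \esum_(m in Zpar) (powR (1 + m%:~R ^+ 2 / 4) s * normc (g m) ^+ 2)%:E.

Definition in_l2s (s : R) (g : int -> R[i]) : Prop :=
  (l2s_sqnorm s g < +oo)%E.

Definition l2s_norm (s : R) (g : int -> R[i]) : R :=
  Num.sqrt (fine (l2s_sqnorm s g)).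

Definition cubic (m : int) (U : int -> R[i]) : R[i] :=
  csum (Zpar `*` Zpar)
    (fun p => U p.1 * (U (- p.2))^* * U (m - p.1 - p.2)).

Variables (W : R -> R) (sigma Omega epsilon : R).

Definition omega_sq : R := n%:R ^+ 2 / 4 + epsilon * Omega.

Definition lattice_eq (U : int -> R[i]) (m : int) : Prop :=
  (omega_sq - m%:~R ^+ 2 / 4)%:C * U m
    + epsilon%:C * csum Zpar (fun k => wcoef W (m - k) * U k)
  = epsilon%:C * sigma%:C * cubic m U.

Definition ansatz (a b : R[i]) (g : int -> R[i]) (m : int) : R[i] :=
  (if m == n%:Z then a else 0) + (if m == - n%:Z then b else 0) + g m.

Definition off_resonant_solution (s : R) (a b : R[i]) (g : int -> R[i]) : Prop :=
  [/\ in_l2s s g, g n%:Z = 0, g (- n%:Z) = 0 &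
      forall m, Zpar m -> m != n%:Z -> m != - n%:Z ->
        lattice_eq (ansatz a b g) m].

(* G is the solution map (a, b) |-> G_epsilon(a, b): for |a| + |b| < delta,
   G a b is the only solution of the lattice equations with m <> n, -n in the
   ball of radius r of l^2_s(Z'). *)
Definition is_solution_map (s delta r : R)
    (G : R[i] -> R[i] -> int -> R[i]) : Prop :=
  forall a b : R[i], normc a + normc b < delta ->
    [/\ off_resonant_solution s a b (G a b),
        l2s_norm s (G a b) < r &
        forall g, off_resonant_solution s a b g -> l2s_norm s g < r ->
          forall m, Zpar m -> g m = G a b m].

Variable G : R[i] -> R[i] -> int -> R[i].

Definition Aterm (a b : R[i]) : R[i] :=
  (epsilon^-1)%:C *
  (- csum (Zpar `\` [set n%:Z; - n%:Z]) (fun k => wcoef W (n%:Z - k) * G a b k)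
   + sigma%:C * (cubic n%:Z (ansatz a b (G a b))
                 - (normc a ^+ 2 + 2 * normc b ^+ 2)%:C * a)).

Definition Bterm (a b : R[i]) : R[i] :=
  (epsilon^-1)%:C *
  (- csum (Zpar `\` [set n%:Z; - n%:Z])
       (fun k => wcoef W (- n%:Z - k) * G a b k)
   + sigma%:C * (cubic (- n%:Z) (ansatz a b (G a b))
                 - (2 * normc a ^+ 2 + normc b ^+ 2)%:C * b)).

Definition coupled_system (a b : R[i]) : Prop :=
  Omega%:C * a + wcoef W (2 * n%:Z) * b
    - sigma%:C * (normc a ^+ 2 + 2 * normc b ^+ 2)%:C * a
    = epsilon%:C * Aterm a b /\
  Omega%:C * b + wcoef W (- (2 * n%:Z)) * a
    - sigma%:C * (2 * normc a ^+ 2 + normc b ^+ 2)%:C * b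
    = epsilon%:C * Bterm a b.

Definition scalar_eq (a : R[i]) : Prop :=
  Omega%:C * a + wcoef W (2 * n%:Z) * a^*
    - 3 * sigma%:C * (normc a ^+ 2)%:C * a
  = epsilon%:C * Aterm a a^*.

Definition solution (a b : R[i]) (x : R) : R[i] :=
  (Num.sqrt epsilon)%:C *
  (a * expi (n%:R * x / 2) + b * expi (- (n%:R * x / 2))
   + csum Zpar (fun m => G a b m * expi (m%:~R * x / 2))).

End Lattice.

(* Main.v *)
(* The reflection g_m |-> conj(g_{-m}) is complex conjugation of U on the level of
   Fourier coefficients.  As W is real, conj(w_k) = w_{-k}, so this reflection maps
   solutions of the off-resonant lattice equations with data (a, conj a) to solutions
   with the same data and the same l^2_s norm.  By uniqueness G(a, conj a) is fixed
   by it; hence B = conj A, the second equation is the conjugate of the first one,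
   and U is real. *)
Require Import Defs.
From mathcomp Require Import zify ring.
Set Implicit Arguments.
Unset Strict Implicit.
Unset Printing Implicit Defensive.

Local Open Scope classical_set_scope.
Local Open Scope ring_scope.
Local Open Scope complex_scope.

(* As an operand of a product, [x^*] is parsed in ring_scope, hence as Num.conj. *)
Lemma conjcE (R : rcfType) (x : R[i]) : Num.conj x = conjc x.
Proof. by []. Qed.

Lemma conjcM (R : rcfType) (x y : R[i]) : conjc (x * y) = conjc x * conjc y.
Proof. exact: rmorphM. Qed.

Lemma conjcD (R : rcfType) (x y : R[i]) : conjc (x + y) = conjc x + conjc y.
Proof. exact: rmorphD. Qed.

Lemma conjcN (R : rcfType) (x : R[i]) : conjc (- x) = - conjc x.
Proof. exact: rmorphN. Qed.

(** * Unordered sums under conjugation and under reindexing by an involution *)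

Lemma cvg_conjc (R : realType) (T : Type) (F : set_system T) (FF : Filter F)
    (f : T -> R[i]^o) (l : R[i]^o) :
  f @ F --> l -> (fun t => (f t)^* : R[i]^o) @ F --> (l^* : R[i]^o).
Proof.
move=> /(@cvgrPdist_lt R[i] R[i]^o) fl; apply/(@cvgrPdist_lt R[i] R[i]^o) => e /fl.
apply: filterS => t.
have -> : l^* - (f t)^* = (l - f t)^* by rewrite rmorphB.
by rewrite [X in _ -> X < _](normcJ (l - f t)).
Qed.

(* If f diverges then both limits are the junk value [point], which h has to fix;
   in this way the identities below for csum need no summability hypothesis. *)
Lemma lim_transfer (K : numFieldType) (V : normedModType K) (S T : Type)
    (F : set_system S) (F' : set_system T)
    (FF : ProperFilter F) (FF' : ProperFilter F')
    (f : S -> V) (f' : T -> V) (h : V -> V) (h0 : h point = point)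
    (hE : forall l : V, f @ F --> l -> f' @ F' --> h l)
    (hN : cvg (f' @ F') -> cvg (f @ F)) :
  lim (f' @ F') = h (lim (f @ F)).
Proof.
have [cf|df] := pselect (cvg (f @ F)).
  by apply: cvg_lim => //; exact: hE.
by rewrite (dvgP df) h0; apply: dvgP => /hN.
Qed.

#[local] Existing Instance totally_filter.

Lemma partial_sum_conjc (R : realType) (I : choiceType) (x : I -> R[i]) :
  partial_sum (fun i => (x i)^* : R[i]^o) = fun A => (partial_sum (x : I -> R[i]^o) A)^*.
Proof. by apply/funext => A; rewrite /partial_sum rmorph_sum. Qed.

Lemma sum_conjc (R : realType) (I : choiceType) (x : I -> R[i]) :
  sum (fun i => (x i)^* : R[i]^o) = (sum (x : I -> R[i]^o))^*.
Proof.
rewrite /sum partial_sum_conjc.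
apply: (@lim_transfer _ R[i]^o _ _ _ _ _ _ _ _ conjc).
(* The junk limit [point] is 0 here, and conjugation fixes 0. *)
- exact: conjc0.
- by move=> l; apply: cvg_conjc.
- move=> /cvg_ex[l /cvg_conjc fl]; apply/cvg_ex; exists (l^* : R[i]^o).
  by move: fl; under [X in X @ _]eq_fun do rewrite conjcK.
Qed.

(** As [e] is its own inverse, the image of [B] contains [A0] as soon as [B] contains the image of
    [A0]. *)
Lemma cvg_imfset_totally (I : choiceType) (e : I -> I) (eK : involutive e) :
  (fun A : {fset I} => (e @` A)%fset) @ totally --> totally.
Proof.
move=> P [A0 _ A0P]; exists (e @` A0)%fset => // B /= sB; apply: A0P => /=.
apply/fsubsetP => i iA0; apply/imfsetP; exists (e i) => /=; last by rewrite eK.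
by apply/(fsubsetP sB)/imfsetP; exists i.
Qed.

Lemma partial_sum_involutive (V : zmodType) (I : choiceType) (e : I -> I)
    (eK : involutive e) (x : I -> V) :
  partial_sum (x \o e) = partial_sum x \o (fun A : {fset I} => (e @` A)%fset).
Proof.
apply/funext => A; rewrite /partial_sum /=.
rewrite -(big_seq_fsetE _ _ predT (x \o e)) -(big_seq_fsetE _ _ predT x).
by rewrite big_imfset //= => i j _ _; exact: inv_inj.
Qed.

Lemma sum_involutive (K : numFieldType) (V : normedModType K) (I : choiceType)
    (e : I -> I) (eK : involutive e) (x : I -> V) :
  sum (x \o e) = sum x.
Proof.
rewrite /sum; apply: (@lim_transfer _ _ _ _ _ _ _ _ _ _ id) => // [l xl|].
  rewrite partial_sum_involutive//; apply: cvg_comp xl.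
  exact: cvg_imfset_totally.
move=> /cvg_ex[l xl]; apply/cvg_ex; exists l.
have -> : x = (x \o e) \o e by apply/funext => i /=; rewrite eK.
rewrite partial_sum_involutive//; apply: cvg_comp xl.
exact: cvg_imfset_totally.
Qed.

Lemma eq_csum (R : realType) (I : choiceType) (D : set I) (x y : I -> R[i]) :
  (forall i, D i -> x i = y i) -> csum D x = csum D y.
Proof.
move=> xy; apply: (congr1 (@sum I _ R[i]^o)); apply/funext => i /=.
by rewrite /patch; case: ifPn => // /set_mem /xy.
Qed.

(** The common tool for the symmetry identities below, where [e] negates an index or a pair of
    indices. *)
Lemma csum_conj_involutive (R : realType) (I : choiceType) (D : set I)
    (e : I -> I) (eK : involutive e) (De : forall i, D i -> D (e i))
    (x y : I -> R[i]) :
  (forall i, D i -> y i = (x (e i))^*) -> csum D y = (csum D x)^*.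
Proof.
move=> yE; rewrite /csum -sum_conjc.
rewrite -[RHS](sum_involutive eK); apply: (congr1 (@sum I _ R[i]^o)).
apply/funext => i /=.
rewrite /patch; case: ifPn => [|/negP] iD.
  by rewrite inE in iD; rewrite ifT ?yE ?inE//; apply: De.
(* Outside [D] both terms vanish: if [e i] were in [D], so would be [e (e i) = i]. *)
by rewrite ifN ?conjc0 ?inE//; apply/negP => /set_mem /De; rewrite eK -in_setE.
Qed.

(** * Fourier coefficients of a real potential *)

Lemma RintegralN (d : measure_display) (T : measurableType d) (R : realType)
    (mu : {measure set T -> \bar R}) (D : set T) (f : T -> R) :
  Rintegral mu D (fun x => - f x) = - Rintegral mu D f.
Proof.
rewrite /Rintegral integralE [in RHS]integralE.
have -> : (fun x => (- f x)%:E) = (\- (fun x => (f x)%:E))%E by [].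
rewrite funeposN funenegN.
(* Negation swaps the positive and negative parts. If one of their integrals is infinite, [fine]
   gives 0 on both sides, so integrability is not at stake. *)
by move: (integral _ _ _) (integral _ _ _) => [a||] [b||] //=; rewrite ?oppr0// opprB.
Qed.

Lemma cintegral_conjc (R : realType) (D : set R) (f : R -> R[i]) :
  cintegral D (fun x => (f x)^*) = (cintegral D f)^*.
Proof.
rewrite /cintegral /= -RintegralN; congr (_ +i* _); congr Rintegral;
  by apply/funext => x; case: (f x).
Qed.

Lemma expiN (R : realType) (x : R) : expi (- x) = (expi x)^*.
Proof. by rewrite /expi cosN sinN. Qed.

Lemma fourier_coefN (R : realType) (W : R -> R) (m : int) :
  fourier_coef W (- m) = (fourier_coef W m)^*.
Proof.
rewrite /fourier_coef conjcM conjc_real -cintegral_conjc.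
congr (_ * cintegral _ _); apply/funext => x.
by rewrite mulrNz mulNr opprK expiN conjcM conjc_real conjcK.
Qed.

(** For even [k] the division by 2 is exact and so commutes with negation; for odd [k] the rounding
    would break this. *)
Lemma wcoefN (R : realType) (W : R -> R) (k : int) : ~~ odd `|k|%N ->
  wcoef W (- k) = (wcoef W k)^*.
Proof.
move=> ek; rewrite /wcoef -fourier_coefN; congr fourier_coef.
have /dvdzP[j ->] : (2 %| k)%Z by rewrite dvdzE /= dvdn2.
by rewrite -mulNr !mulzK.
Qed.

Lemma normc_conjc (R : rcfType) (x : R[i]) : normc (conjc x) = normc x.
Proof. by case: x => x y /=; rewrite sqrrN. Qed.

Lemma odd_abszD (i j : int) : odd `|(i + j)%R|%N = odd `|i|%N (+) odd `|j|%N.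
Proof. by lia. Qed.

(** * Invariance of the lattice system under reflection and conjugation *)

Section Reflection.
Context {R : realType}.
Variable n : nat.
Implicit Types (U g : int -> R[i]) (a : R[i]) (m : int).

(* The Fourier coefficients of the complex conjugate of a function whose
   coefficients are g. *)
Definition reflect_conj g m : R[i] := conjc (g (- m)).

Lemma ZparN m : Zpar n m -> Zpar n (- m).
Proof. by rewrite /Zpar /= abszN. Qed.

Lemma Zpar_subD m k1 k2 : Zpar n m -> Zpar n k1 -> Zpar n k2 ->
  Zpar n (m - k1 - k2).
Proof.
rewrite /Zpar /= !odd_abszD !abszN => -> -> ->; exact: addbK.
Qed.

(** Reflection exchanges the sites [n] and [-n] and conjugates their amplitudes; for the amplitudes
    [a] and [conjc a] the two effects cancel. *)
Lemma reflect_ansatz a g :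
  reflect_conj (ansatz n a (conjc a) g) =1
  ansatz n a (conjc a) (reflect_conj g).
Proof.
move=> m; rewrite /reflect_conj /ansatz !conjcD eqr_oppLR eqr_opp.
congr (_ + _); rewrite addrC.
by do 2 case: eqP => _; rewrite ?conjcK ?conjc0.
Qed.

Lemma cubic_reflect U m :
  cubic n m (reflect_conj U) = conjc (cubic n (- m) U).
Proof.
apply: (@csum_conj_involutive _ _ _ (fun p => (- p.1, - p.2))).
- by case=> k l /=; rewrite !opprK.
- by case=> k l [? ?]; split; exact: ZparN.
- by case=> k l _ /=; rewrite !conjcM !conjcE /reflect_conj !opprD !opprK.
Qed.

(** Needed because uniqueness identifies [G] with its reflection only on [Zpar n]; the third index
    [m - k - l] keeps the parity of [n]. *)
Lemma eq_cubic U V m : (forall k, Zpar n k -> U k = V k) -> Zpar n m ->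
  cubic n m U = cubic n m V.
Proof.
move=> UV nm; apply: eq_csum => -[k l] [/= nk nl].
by rewrite !UV//; [exact: Zpar_subD|exact: ZparN].
Qed.

Lemma convolution_reflect W U m : Zpar n m ->
  csum (Zpar n) (fun k => wcoef W (m - k) * reflect_conj U k) =
  conjc (csum (Zpar n) (fun k => wcoef W (- m - k) * U k)).
Proof.
move=> nm; apply: (@csum_conj_involutive _ _ _ -%R) => [k|k|k nk].
- exact: opprK.
- exact: ZparN.
- rewrite conjcM -wcoefN; first by rewrite opprD !opprK.
  (* [m] and [k] have the same parity, so the index of [wcoef] is even. *)
  by rewrite opprK odd_abszD abszN nm nk addbb.
Qed.

(** The scalar coefficients are real and depend on [m] only through its square, so conjugating the
    equation at [-m] gives the one at [m]. *)
Lemma lattice_eq_reflect W sigma Omega epsilon U m : Zpar n m ->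
  lattice_eq n W sigma Omega epsilon U (- m) ->
  lattice_eq n W sigma Omega epsilon (reflect_conj U) m.
Proof.
move=> nm /(congr1 conjc); rewrite /lattice_eq !(conjcD, conjcM, conjc_real).
by rewrite convolution_reflect// cubic_reflect mulrNz sqrrN.
Qed.

Lemma eq_lattice_eq W sigma Omega epsilon U V m : U =1 V ->
  lattice_eq n W sigma Omega epsilon U m -> lattice_eq n W sigma Omega epsilon V m.
Proof. by move=> /funext ->. Qed.

Lemma l2s_sqnorm_reflect s g : l2s_sqnorm n s (reflect_conj g) = l2s_sqnorm n s g.
Proof.
rewrite /l2s_sqnorm [RHS](reindex_esum (Zpar n) (Zpar n) -%R).
  by apply: eq_esum => m _; rewrite normc_conjc mulrNz sqrrN.
split=> [m|m1 m2 _ _|m nm]; [exact: ZparN|exact: oppr_inj|].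
by exists (- m); [exact: ZparN|rewrite opprK].
Qed.

Lemma off_resonant_solution_reflect W sigma Omega epsilon s a g :
  off_resonant_solution n W sigma Omega epsilon s a (conjc a) g ->
  off_resonant_solution n W sigma Omega epsilon s a (conjc a) (reflect_conj g).
Proof.
move=> [g2 gn gNn g_eq]; split.
- by rewrite /in_l2s l2s_sqnorm_reflect.
- by rewrite /reflect_conj gNn conjc0.
- by rewrite /reflect_conj opprK gn conjc0.
- move=> m nm mn mNn; apply: (eq_lattice_eq (reflect_ansatz a g)).
  apply: lattice_eq_reflect => //; apply: g_eq; first exact: ZparN.
  + by rewrite eqr_oppLR.
  + by rewrite eqr_opp.
Qed.

Lemma solution_map_reflect W sigma Omega epsilon s delta r G a :
  is_solution_map n W sigma Omega epsilon s delta r G ->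
  normc a + normc (conjc a) < delta ->
  forall m, Zpar n m -> reflect_conj (G a (conjc a)) m = G a (conjc a) m.
Proof.
move=> G_map /G_map[Gsol Gr Guniq]; apply: Guniq.
  exact: off_resonant_solution_reflect.
(* The reflected sequence stays in the ball of radius [r] where uniqueness holds. *)
by rewrite /l2s_norm l2s_sqnorm_reflect.
Qed.

Lemma Bterm_conj W sigma epsilon G a :
  (forall m, Zpar n m -> reflect_conj (G a (conjc a)) m = G a (conjc a) m) ->
  Bterm n W sigma epsilon G a (conjc a) = conjc (Aterm n W sigma epsilon G a (conjc a)).
Proof.
move=> GE; have nn : Zpar n n%:Z by [].
rewrite /Aterm /Bterm !(conjcM, conjcD, conjcN, conjc_real).
congr (_ * (- _ + _ * (_ - _))).
- apply: (@csum_conj_involutive _ _ _ -%R) => [k|k|k [nk _]].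
  + exact: opprK.
  + move=> [nk nk']; split; first exact: ZparN.
    move=> /= h; apply: nk'.
    by case: h => [<-|/oppr_inj ->]; rewrite ?opprK; [right|left].
  + rewrite -GE// conjcM -wcoefN; first by rewrite opprD !opprK.
    by rewrite opprK odd_abszD nn nk addbb.
(* The inserted double negations and conjugations bring the left side to the form required by
   [cubic_reflect], which moves the index from [-n] to [n]. *)
- rewrite -[in LHS](opprK n%:Z) -[LHS]conjcK -cubic_reflect opprK; congr conjc.
  apply: eq_cubic => // k nk; rewrite reflect_ansatz; congr (_ + _); exact: GE.
- by rewrite normc_conjc addrC.
Qed.

Lemma solution_conj epsilon G a x :
  (forall m, Zpar n m -> reflect_conj (G a (conjc a)) m = G a (conjc a) m) ->
  conjc (solution n epsilon G a (conjc a) x) = solution n epsilon G a (conjc a) x.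
Proof.
move=> GE; rewrite /solution !(conjcM, conjcD, conjc_real) conjcK -!expiN !opprK.
congr (_ * (_ + _)); first exact: addrC.
symmetry; apply: (@csum_conj_involutive _ _ _ -%R) => [k|k|k nk].
- exact: opprK.
- exact: ZparN.
- by rewrite -GE// conjcM -expiN mulrNz !mulNr opprK.
Qed.

End Reflection.

Theorem corollary1 (R : realType) (W : R -> R) (n : nat)
    (s sigma Omega epsilon delta r : R) (G : R[i] -> R[i] -> int -> R[i])
    (W_smooth : smooth W)
    (W_periodic : forall x : R, W (x + 2 * pi) = W x)
    (W_mean0 : Rintegral lebesgue_measure `[- pi, pi] W = 0)
    (W_even : forall x : R, W (- x) = W x)
    (w2n_neq0 : wcoef W (2 * n%:Z) != 0)
    (s_gt : 2^-1 < s) (delta_gt0 : 0 < delta) (r_gt0 : 0 < r)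
    (epsilon_gt0 : 0 < epsilon)
    (G_map : is_solution_map n W sigma Omega epsilon s delta r G) :
  forall a : R[i], normc a + normc a^* < delta ->
    (coupled_system n W sigma Omega epsilon G a a^*
       <-> scalar_eq n W sigma Omega epsilon G a) /\
    (coupled_system n W sigma Omega epsilon G a a^* ->
       forall x : R, complex.Im (solution n epsilon G a a^* x) = 0).
Proof.
move=> a a_lt; have GE := solution_map_reflect G_map a_lt.
split; last first.
  move=> _ x; move: (solution_conj epsilon x GE).
  by case: (solution _ _ _ _ _ _) => u v [] /eqP; rewrite eqNr => /eqP.
rewrite /coupled_system /scalar_eq Bterm_conj// normc_conjc.
have -> : normc a ^+ 2 + 2 * normc a ^+ 2 = 3 * normc a ^+ 2 by ring.
have -> : 2 * normc a ^+ 2 + normc a ^+ 2 = 3 * normc a ^+ 2 by ring.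
(* The complex numeral 3 is moved inside the real embedding, to match the coefficient in the
   system. *)
have -> : 3 * sigma%:C * (normc a ^+ 2)%:C * a = sigma%:C * (3 * normc a ^+ 2)%:C * a.
  rewrite -(rmorph_nat (real_complex R) 3) (mulrC _ sigma%:C) -!mulrA; congr (_ * _).
  by rewrite mulrA; congr (_ * _); rewrite -rmorphM.
rewrite wcoefN; last by lia.
set A := Aterm _ _ _ _ _ _ _; set w := wcoef _ _.
(* The scalar equation is the first equation of the system, and its conjugate is the second. *)
split=> [[]//|eqA]; split=> //; move/(congr1 conjc): eqA.
by rewrite !(conjcM, conjcD, conjcN, conjc_real) conjcK.
Qed.
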